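(* As formal power series, $$\sum_{\pi \in \mathcal{P}_{2}}x^{|\pi|}y^{\mathrm{asc}(\pi)} = \sum_{n\ge 0}\ \sum_{k\ge 0} a(n,k)\, x^n y^k= \frac{1-xy-x^2y+x^3y-2x^3y^2}{1-x-xy-x^2y-2x^3y^2}.$$
   Context: $\mathcal{S}_n$ is the set of permutations of $\{1,\dots,n\}$, written as words; $|\pi|$ denotes the length of $\pi$. An ascent of $\pi$ is an index $i$ with $\pi_i<\pi_{i+1}$, and $\mathrm{asc}(\pi)$ is the number of ascents of $\pi$. Pop stack operator: for a word $\pi=\pi_1\cdots\pi_n$ of distinct integers with longest decreasing prefix $\pi_1\cdots\pi_i$, define recursively $P(\pi)=\pi_i\pi_{i-1}\cdots\pi_1\,P(\pi_{i+1}\cdots\pi_n)$, with $P$ of the empty word being empty. So $P$ reverses each maximal contiguous decreasing run. $\pi\in\mathcal{S}_n$ is two-pop-stack sortable if $P(P(\pi))=12\cdots n$; $\mathcal{P}_{2,n}$ is the set of such $\pi\in\mathcal{S}_n$ and $\mathcal{P}_2=\bigcup_{n\ge0}\mathcal{P}_{2,n}$. The empty permutation (length $0$, with $0$ ascents) belongs to $\mathcal{P}_{2,0}$. $a(n,k)=|\{\pi\in\mathcal{P}_{2,n} : \mathrm{asc}(\pi)=k\}|$. *)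

(* Defs.v *)
From HB Require Import structures.
From mathcomp Require Import all_boot all_order all_algebra.
From mathcomp Require Import boolp classical_sets functions cardinality fsbigop.

Set Implicit Arguments.
Unset Strict Implicit.
Unset Printing Implicit Defensive.

Import GRing.Theory.

(* Bivariate formal power series: [f i j] is the coefficient of x^i y^j. *)
Record fps2 (R : Type) := Fps2 { coef2 :> nat -> nat -> R }.

Lemma fps2P (R : Type) (f g : fps2 R) : (forall i j, f i j = g i j) -> f = g.
Proof.
case: f g => [f] [g] /= fg; congr Fps2.
by apply/funext => i; apply/funext => j; apply: fg.
Qed.

HB.instance Definition _ (R : Type) := gen_eqMixin (fps2 R).
HB.instance Definition _ (R : Type) := gen_choiceMixin (fps2 R).

Section Ring.
Local Open Scope ring_scope.
Variable R : comNzRingType.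
Implicit Types f g h : fps2 R.

Definition fps2_zero : fps2 R := Fps2 (fun _ _ => 0).
Definition fps2_opp f : fps2 R := Fps2 (fun i j => - f i j).
Definition fps2_add f g : fps2 R := Fps2 (fun i j => f i j + g i j).
Definition fps2_one : fps2 R := Fps2 (fun i j => ((i == 0) && (j == 0))%N%:R).
Definition fps2_mul f g : fps2 R :=
  Fps2 (fun i j => \sum_(a < i.+1) \sum_(b < j.+1) f a b * g (i - a)%N (j - b)%N).

Fact fps2_addA : associative fps2_add.
Proof. by move=> f g h; apply: fps2P => i j /=; rewrite addrA. Qed.
Fact fps2_addC : commutative fps2_add.
Proof. by move=> f g; apply: fps2P => i j /=; rewrite addrC. Qed.
Fact fps2_add0 : left_id fps2_zero fps2_add.
Proof. by move=> f; apply: fps2P => i j /=; rewrite add0r. Qed.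
Fact fps2_addN : left_inverse fps2_zero fps2_opp fps2_add.
Proof. by move=> f; apply: fps2P => i j /=; rewrite addNr. Qed.

HB.instance Definition _ := GRing.isZmodule.Build (fps2 R)
  fps2_addA fps2_addC fps2_add0 fps2_addN.

(* The ring axioms are transported from {poly {poly R}}: a coefficient of a
   product only depends on truncations of the factors. *)
Let tr (n : nat) f : {poly {poly R}} := \poly_(i < n) \poly_(j < n) f i j.

Let coef_tr n f i j : (i < n)%N -> (j < n)%N -> (tr n f)`_i`_j = f i j.
Proof. by move=> lin ljn; rewrite coef_poly lin coef_poly ljn. Qed.

Let coefM2 (p q : {poly {poly R}}) i j :
  (p * q)`_i`_j = \sum_(a < i.+1) \sum_(b < j.+1) p`_a`_b * q`_(i - a)`_(j - b).
Proof.
rewrite coefM coef_sum; apply: eq_bigr => a _.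
by rewrite coefM.
Qed.

Let eq_coefM2 n (p p' q q' : {poly {poly R}}) :
  (forall i j, (i < n)%N -> (j < n)%N -> p`_i`_j = p'`_i`_j) ->
  (forall i j, (i < n)%N -> (j < n)%N -> q`_i`_j = q'`_i`_j) ->
  forall i j, (i < n)%N -> (j < n)%N -> (p * q)`_i`_j = (p' * q')`_i`_j.
Proof.
move=> pp' qq' i j lin ljn; rewrite !coefM2.
apply: eq_bigr => a _; apply: eq_bigr => b _.
have la : (a <= i)%N by rewrite -ltnS.
have lb : (b <= j)%N by rewrite -ltnS.
rewrite pp' ?qq' //.
- exact: leq_ltn_trans (leq_subr _ _) lin.
- exact: leq_ltn_trans (leq_subr _ _) ljn.
- exact: leq_ltn_trans la lin.
- exact: leq_ltn_trans lb ljn.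
Qed.

Let tr_mul n f g i j : (i < n)%N -> (j < n)%N ->
  (tr n (fps2_mul f g))`_i`_j = (tr n f * tr n g)`_i`_j.
Proof.
move=> lin ljn; rewrite coef_tr // coefM2 /=.
apply: eq_bigr => a _; apply: eq_bigr => b _.
have la : (a <= i)%N by rewrite -ltnS.
have lb : (b <= j)%N by rewrite -ltnS.
rewrite !coef_tr //.
- exact: leq_ltn_trans (leq_subr _ _) lin.
- exact: leq_ltn_trans (leq_subr _ _) ljn.
- exact: leq_ltn_trans la lin.
- exact: leq_ltn_trans lb ljn.
Qed.

Let fps2_trP f g :
  (forall n i j, (i < n)%N -> (j < n)%N -> (tr n f)`_i`_j = (tr n g)`_i`_j) ->
  f = g.
Proof.
move=> fg; apply: fps2P => i j.
have li : (i < (maxn i j).+1)%N by rewrite ltnS leq_maxl.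
have lj : (j < (maxn i j).+1)%N by rewrite ltnS leq_maxr.
by have := fg _ _ _ li lj; rewrite !coef_tr.
Qed.

Fact fps2_mulC : commutative fps2_mul.
Proof.
by move=> f g; apply: fps2_trP => n i j li lj; rewrite !tr_mul // mulrC.
Qed.

Fact fps2_mulA : associative fps2_mul.
Proof.
move=> f g h; apply: fps2_trP => n i j li lj; rewrite !tr_mul //.
rewrite (@eq_coefM2 n _ (tr n f) _ (tr n g * tr n h)) //; last first.
  by move=> *; rewrite tr_mul.
rewrite mulrA; apply: (@eq_coefM2 n) => // *; by rewrite tr_mul.
Qed.

Fact fps2_mul1 : left_id fps2_one fps2_mul.
Proof.
move=> f; apply: fps2P => i j /=.
rewrite big_ord_recl big_ord_recl /= mul1r !subn0.
by rewrite !big1 ?addr0 // => a _; rewrite ?big1 // => *; rewrite mul0r.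
Qed.

Fact fps2_mulD : left_distributive fps2_mul fps2_add.
Proof.
move=> f g h; apply: fps2P => i j /=.
rewrite -big_split; apply: eq_bigr => a _ /=.
by rewrite -big_split; apply: eq_bigr => b _ /=; rewrite mulrDl.
Qed.

Fact fps2_1neq0 : fps2_one != 0.
Proof.
apply/eqP => /(congr1 (fun f : fps2 R => f 0%N 0%N)) /= /eqP.
by rewrite oner_eq0.
Qed.

HB.instance Definition _ := GRing.Zmodule_isComNzRing.Build (fps2 R)
  fps2_mulA fps2_mulC fps2_mul1 fps2_mulD fps2_1neq0.

Definition fps2_unit : pred (fps2 R) := fun f => `[< exists g, g * f = 1 >].

Definition fps2_inv f : fps2 R :=
  if pselect (exists g, g * f = 1) is left ex then projT1 (cid ex) else f.

Fact fps2_mulVf : {in fps2_unit, left_inverse 1 fps2_inv *%R}.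
Proof.
move=> f /asboolP ex; rewrite /fps2_inv.
by case: pselect => // ex'; case: cid.
Qed.

Fact fps2_unitPl f g : g * f = 1 -> fps2_unit f.
Proof. by move=> gf; apply/asboolP; exists g. Qed.

Fact fps2_inv_out : {in [predC fps2_unit], fps2_inv =1 id}.
Proof.
by move=> f /asboolP nex; rewrite /fps2_inv; case: pselect.
Qed.

HB.instance Definition _ := GRing.ComNzRing_hasMulInverse.Build (fps2 R)
  fps2_mulVf fps2_unitPl fps2_inv_out.

Lemma coef2D f g i j : (f + g) i j = f i j + g i j. Proof. by []. Qed.
Lemma coef2N f i j : (- f) i j = - f i j. Proof. by []. Qed.
Lemma coef20 i j : (0 : fps2 R) i j = 0. Proof. by []. Qed.
Lemma coef21 i j : (1 : fps2 R) i j = ((i == 0) && (j == 0))%N%:R.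
Proof. by []. Qed.
Lemma coef2M f g i j : (f * g) i j =
  \sum_(a < i.+1) \sum_(b < j.+1) f a b * g (i - a)%N (j - b)%N.
Proof. by []. Qed.
Lemma coef2_sum (I : Type) (r : seq I) (P : pred I) (F : I -> fps2 R) i j :
  (\sum_(k <- r | P k) F k) i j = \sum_(k <- r | P k) F k i j.
Proof. exact: (big_morph (fun f : fps2 R => f i j)). Qed.

Let coef2X0 f n i j : f 0%N 0%N = 0 -> (i + j < n)%N -> (f ^+ n) i j = 0.
Proof.
move=> f0; elim: n i j => [//|n IHn] i j lijn.
rewrite exprS coef2M big1 // => a _; rewrite big1 // => b _.
have [a0|a_gt0] := posnP a; have [b0|b_gt0] := posnP b;
  first by rewrite a0 b0 f0 mul0r.
all: rewrite IHn ?mulr0 //; move: (ltn_ord a) (ltn_ord b); rewrite !ltnS => *.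
all: apply: leq_trans (_ : (i + j <= n)%N) => //.
- by rewrite -addnS leq_add ?leq_subr // ltn_subrL b_gt0 (leq_trans b_gt0).
- by rewrite -addSn leq_add ?leq_subr // ltn_subrL a_gt0 (leq_trans a_gt0).
- by rewrite -addSn leq_add ?leq_subr // ltn_subrL a_gt0 (leq_trans a_gt0).
Qed.

(* Series with constant coefficient 1 are invertible, so that [f / g] is the
   genuine quotient for such a [g]. *)
Lemma fps2_unit_coef1 f : f 0%N 0%N = 1 -> f \is a GRing.unit.
Proof.
move=> f1; pose u : fps2 R := 1 - f.
have u0 : u 0%N 0%N = 0 by rewrite coef2D coef2N coef21 f1 subrr.
pose G n : fps2 R := \sum_(m < n) u ^+ m.
have Gf n : G n * f = 1 - u ^+ n.
  rewrite mulrC; have -> : f = 1 - u by rewrite /u opprB addrCA subrr addr0.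
  have := subrXX 1 u n; rewrite expr1n => ->; congr (_ * _).
  by rewrite /G; apply: eq_bigr => m _; rewrite expr1n mul1r.
have GE n i j : (i + j < n)%N -> G n i j = G (i + j).+1 i j.
  move=> lijn; rewrite /G !coef2_sum.
  rewrite [RHS](big_ord_widen n (fun m => (u ^+ m) i j)) // [RHS]big_mkcond.
  apply: eq_bigr => m _; case: ltnP => // lm; exact: coef2X0.
apply: (@fps2_unitPl _ (Fps2 (fun i j => G (i + j).+1 i j))).
apply: fps2P => i j; rewrite coef2M /=.
transitivity ((G (i + j).+1 * f) i j); last first.
  by rewrite Gf coef2D coef2N coef2X0 // subr0.
rewrite coef2M; apply: eq_bigr => a _; apply: eq_bigr => b _.
by rewrite [in RHS]GE // ltnS leq_add // -ltnS.
Qed.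

Definition fps2_x : fps2 R := Fps2 (fun i j => ((i == 1) && (j == 0))%N%:R).
Definition fps2_y : fps2 R := Fps2 (fun i j => ((i == 0) && (j == 1))%N%:R).

(* Coefficientwise sum of a summable family. Finiteness has to be required:
   [\sum_(t \in A) _] is 0 by convention when the support is infinite. *)
Definition fps2_has_sum (I : choiceType) (A : set I) (F : I -> fps2 R)
    (S : fps2 R) : Prop :=
  forall i j,
    finite_set (A `&` [set t | F t i j != 0])%classic /\
    S i j = \sum_(t \in A) F t i j.

End Ring.

Definition asc (w : seq nat) : nat :=
  count (fun i => nth 0 w i < nth 0 w i.+1) (iota 0 (size w).-1).

(* Length of the longest decreasing prefix. *)
Definition decpref (w : seq nat) : nat :=
  \max_(i < (size w).+1 | sorted gtn (take i w)) i.

Lemma decpref_gt0 x w : 0 < decpref (x :: w).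
Proof.
have l1 : 1 < (size (x :: w)).+1 by [].
rewrite /decpref (bigD1 (Ordinal l1)) /=; last by rewrite take0.
by rewrite leq_max.
Qed.

(* The first argument bounds the number of recursive calls; [size w] suffices,
   see [popE]. *)
Fixpoint pop_rec (m : nat) (w : seq nat) : seq nat :=
  if m is m'.+1 then
    rev (take (decpref w) w) ++ pop_rec m' (drop (decpref w) w)
  else [::].

Definition pop (w : seq nat) : seq nat := pop_rec (size w) w.

Lemma pop_rec_size m w : size w <= m -> pop_rec m w = pop w.
Proof.
rewrite /pop; elim/ltn_ind: m w => m IHm [|x w] lwm.
  by case: m {IHm lwm} => //; elim=> //= m ->.
case: m IHm lwm => // m IHm lwm /=; congr (_ ++ _).
have ld : size (drop (decpref (x :: w)) (x :: w)) <= size w.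
  rewrite size_drop -[X in _ <= X](subn1 (size w).+1) /=.
  exact: leq_sub2l (decpref_gt0 x w).
rewrite IHm //; last exact: leq_trans ld lwm.
case: (ltnP (size w) m.+1) => [lw|]; last by rewrite ltnNge -ltnS lwm.
by rewrite (IHm (size w)).
Qed.

Lemma pop_nil : pop [::] = [::]. Proof. by []. Qed.

Lemma popE w : pop w = rev (take (decpref w) w) ++ pop (drop (decpref w) w).
Proof.
case: w => [|x w]; first by rewrite /= pop_nil.
rewrite {1}/pop /=; congr (_ ++ _); apply: pop_rec_size.
rewrite size_drop -[X in _ <= X](subn1 (size w).+1) /=.
exact: leq_sub2l (decpref_gt0 x w).
Qed.

(* [permutations (iota 1 n)] lists the words of the permutations of 1..n,
   each exactly once. *)
Definition two_pop_sortable (n : nat) : seq (seq nat) :=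
  [seq w <- permutations (iota 1 n) | pop (pop w) == iota 1 n].

Definition two_pop_sortable_all : set (seq nat) :=
  [set w | exists n, w \in two_pop_sortable n]%classic.

Definition asc_count (n k : nat) : nat :=
  count (fun w => asc w == k) (two_pop_sortable n).

(* Main.v *)
(** A permutation [w] is two-pop-stack sortable iff [pop w] is layered, i.e. a
direct sum of decreasing permutations: layered permutations are the words that
[pop] maps to the identity. So [w] is recovered from the set of its descents,
whose runs say which blocks of [pop w] to reverse, and from the set of descents
of [pop w], whose runs give the layers. No position is in both sets, so a
permutation of length n+1 becomes a word of length n over three letters: descent
of [w] (J), ascent of [w] and of [pop w] (A), ascent of [w] and descent of
[pop w] (D). The words that occur are those in which each D is adjacent to a J,
and asc w is the number of letters other than J. Reading words from left to
right, with G and H the generating functions of the suffixes allowed after a J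
and after another letter (or at the start),

    G = 1 + x G + 2 x y H,    H = 1 + x G + x y H + x^2 y G,

and the generating function of the theorem is 1 + x H. *)

Require Import Defs.
From mathcomp Require Import all_boot all_order all_algebra.
From mathcomp Require Import boolp classical_sets functions cardinality fsbigop.
From mathcomp Require Import zify ring.
Import GRing.Theory.

(** * Reversing the blocks of a set partition into intervals *)

Section Blocks.
Variables (n : nat) (J : nat -> bool).

(* [J k] says that positions [k] and [k+1] lie in the same block. *)
Definition is_block (a b : nat) : Prop :=
  [/\ a <= b, forall k, a <= k < b -> J k, 0 < a -> ~~ J a.-1 & ~~ J b].

Fixpoint block_lo (i : nat) : nat :=
  if i is i'.+1 then if J i' then block_lo i' else i else 0.

(** The first argument is fuel; [n] steps reach the end of the block when [J i] implies
    [i.+1 < n]. *)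
Fixpoint block_hi_rec (m i : nat) : nat :=
  if m is m'.+1 then if J i then block_hi_rec m' i.+1 else i else i.

Definition block_hi (i : nat) : nat := block_hi_rec n i.

Definition block_rev (i : nat) : nat := block_lo i + block_hi i - i.

Hypothesis J_lt : forall i, J i -> i.+1 < n.

Lemma block_loP i :
  [/\ block_lo i <= i, forall k, block_lo i <= k < i -> J k
    & 0 < block_lo i -> ~~ J (block_lo i).-1].
Proof.
elim: i => [|i [le_lo J_lo nJ_lo]] /=; first by split=> // k; lia.
case Ji: (J i); last by split=> // [k|_]; [lia|rewrite /= Ji].
split=> // [|k hk]; first exact: leqW.
by have [->//|ki] := eqVneq k i; apply: J_lo; lia.
Qed.

Lemma block_hiP i :
  [/\ i <= block_hi i, forall k, i <= k < block_hi i -> J k & ~~ J (block_hi i)].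
Proof.
rewrite /block_hi.
have hm : n <= i + n by apply: leq_addl.
elim: {2 3 4 5}n i hm => [|m IHm] i hm /=.
  by split=> // [k|]; [lia|apply/negP => /J_lt; lia].
case Ji: (J i); last by split=> // [k|]; [lia|rewrite Ji].
have [|le_hi J_hi nJ_hi] := IHm i.+1; first by lia.
split=> // [|k hk]; first exact: ltnW.
by have [->//|ki] := eqVneq k i; apply: J_hi; lia.
Qed.

Lemma block_lo_hi i : is_block (block_lo i) (block_hi i).
Proof.
have [le_lo J_lo nJ_lo] := block_loP i; have [le_hi J_hi nJ_hi] := block_hiP i.
split=> // [|k hk]; first exact: leq_trans le_hi.
by have [ki|ik] := ltnP k i; [apply: J_lo|apply: J_hi]; lia.
Qed.

(** If two blocks through [i] had different ends, one end would be a gap cut in one block and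
    interior to the other. *)
Lemma block_uniq a b c d i : is_block a b -> is_block c d ->
  a <= i <= b -> c <= i <= d -> (a = c) * (b = d).
Proof.
move=> [ab Jab nJa nJb] [cd Jcd nJc nJd] iab icd; split.
  have [ac|ca|//] := ltngtP a c.
    by case/negP: (nJc (leq_ltn_trans (leq0n a) ac)); apply: Jab; lia.
  by case/negP: (nJa (leq_ltn_trans (leq0n c) ca)); apply: Jcd; lia.
have [bd|db|//] := ltngtP b d.
  by case/negP: nJb; apply: Jcd; lia.
by case/negP: nJd; apply: Jab; lia.
Qed.

Lemma block_revE a b i : is_block a b -> a <= i <= b -> block_rev i = a + b - i.
Proof.
move=> bab iab; rewrite /block_rev.
have [lo_le _ _] := block_loP i; have [le_hi _ _] := block_hiP i.
have [|-> -> //] := block_uniq _ _ _ _ i (block_lo_hi i) bab _ iab.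
by rewrite lo_le.
Qed.

Lemma block_ex i : exists a b, is_block a b /\ a <= i <= b.
Proof.
exists (block_lo i), (block_hi i); split; first exact: block_lo_hi.
by have [-> _ _] := block_loP i; have [-> _ _] := block_hiP i.
Qed.

Lemma block_lt a b : is_block a b -> 0 < n -> a < n -> b < n.
Proof.
move=> [ab Jab _ _] n_gt0 an; have [ba|ab'] := leqP b a; first exact: leq_ltn_trans an.
have /J_lt : J b.-1 by apply: Jab; lia.
by lia.
Qed.

Lemma block_revK : involutive block_rev.
Proof.
move=> i; have [a [b [bab iab]]] := block_ex i.
by rewrite (block_revE _ _ _ bab iab) (block_revE _ _ _ bab); lia.
Qed.

Lemma block_rev_lt i : i < n -> block_rev i < n.
Proof.
move=> i_lt; have [a [b [bab iab]]] := block_ex i.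
have := block_lt _ _ bab; rewrite (block_revE _ _ _ bab iab).
by case: bab => *; lia.
Qed.

(* Inside a block [block_rev] swaps the gaps [i, i+1] among themselves. *)
Lemma block_rev_gap i : J i ->
  exists2 k, J k & (block_rev i = k.+1) /\ (block_rev i.+1 = k).
Proof.
move=> Ji; have [a [b [bab iab]]] := block_ex i.
have ib : i < b.
  have [_ _ _ nJb] := bab.
  by rewrite ltn_neqAle (andP iab).2 andbT; apply: contraNneq nJb => <-.
exists (a + b - i.+1); first by case: bab => _ + _ _; apply; lia.
by rewrite !(block_revE _ _ _ bab); lia.
Qed.

(** A gap outside [J] ends the block of [i] and starts that of [i.+1], so reflection sends these two
    positions to the far ends of their blocks. *)
Lemma block_rev_cut i : ~~ J i ->
  [/\ is_block (block_rev i) i & is_block i.+1 (block_rev i.+1)].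
Proof.
move=> nJi; have [a [b [bab iab]]] := block_ex i.
have [c [d [bcd icd]]] := block_ex i.+1.
rewrite (block_revE _ _ _ bab iab) (block_revE _ _ _ bcd icd).
have bi : b = i.
  case: bab => _ Jab _ _; apply/eqP; rewrite eqn_leq (andP iab).2 andbT leqNgt.
  by apply: contra nJi => ib; apply: Jab; lia.
have ci : c = i.+1.
  case: bcd => _ Jcd _ _; apply/eqP; rewrite eqn_leq (andP icd).1 leqNgt.
  by apply: contra nJi => ib; apply: Jcd; lia.
by subst b c; rewrite addnK addKn.
Qed.

(** Reflection inverts the order inside a block and keeps the order between blocks; a gap outside
    [J] is what separates two blocks. *)
Lemma block_rev_ltE i j : i < j ->
  block_rev i < block_rev j <-> exists2 k, i <= k < j & ~~ J k.
Proof.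
move=> ij; have [a [b [bab iab]]] := block_ex i.
have [c [d [bcd jcd]]] := block_ex j.
rewrite (block_revE _ _ _ bab iab) (block_revE _ _ _ bcd jcd).
have [jb|bj] := leqP j b.
  have [| |-> ->] := block_uniq _ _ _ _ j bcd bab; [by lia..|].
  split=> [lt|[k hk]]; first by exfalso; lia.
  by case: bab => _ Jab _ _; rewrite Jab; lia.
have bc : b < c.
  case: bcd => _ Jcd _ _; rewrite ltnNge; apply/negP => cb.
  by case: bab => _ _ _ /negP[]; apply: Jcd; lia.
split=> [_|_]; last by lia.
by exists b; [lia|case: bab].
Qed.

End Blocks.

(** * The pop stack operator reverses descending runs *)

(** Without the bound, the default value 0 of [nth] would create a descent after a positive last
    entry. *)
Definition desc (w : seq nat) (i : nat) : bool :=
  (i.+1 < size w) && (nth 0 w i.+1 < nth 0 w i).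

Lemma desc_lt w i : desc w i -> i.+1 < size w.
Proof. by case/andP. Qed.

Lemma desc_drop d w i : desc (drop d w) i = desc w (d + i).
Proof. by rewrite /desc size_drop !nth_drop addnS ltn_subRL addnS. Qed.

Lemma sorted_take_desc d w : d <= size w ->
  sorted gtn (take d w) <-> forall k, k.+1 < d -> desc w k.
Proof.
move=> le_d; have szt : size (take d w) = d by apply: size_takel.
split=> [/(sortedP 0) srt k kd|dsc].
  rewrite /desc (leq_trans kd) //=.
  by have /= := srt k; rewrite szt !nth_take //; [apply | lia].
apply/(sortedP 0) => k; rewrite szt => kd.
by rewrite !nth_take //=; [have /andP[] := dsc _ kd | lia].
Qed.

Lemma decpref_le w : decpref w <= size w.
Proof. by apply/bigmax_leqP => i _; rewrite -ltnS. Qed.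

Lemma sorted_decpref w : sorted gtn (take (decpref w) w).
Proof.
have h0 : sorted gtn (take (@ord0 (size w)) w) by rewrite take0.
rewrite /decpref (bigmax_eq_arg _ h0).
by case: arg_maxnP.
Qed.

Lemma decpref_max w d : d <= size w -> sorted gtn (take d w) -> d <= decpref w.
Proof.
rewrite -ltnS => le_d srt.
by rewrite /decpref (bigmax_sup (Ordinal le_d)).
Qed.

Lemma decpref_block w : 0 < size w -> is_block (desc w) 0 (decpref w).-1.
Proof.
move=> w_gt0; have d_gt0 : 0 < decpref w.
  by case: w w_gt0 => // x w _; apply: decpref_gt0.
have dsc := (sorted_take_desc _ _ (decpref_le w)).1 (sorted_decpref w).
split=> // [k hk|]; first by apply: dsc; lia.
apply/negP => nd; have lt_d := desc_lt _ _ nd; rewrite prednK // in lt_d.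
(* A descent at the end of the prefix would give a longer decreasing prefix. *)
have := decpref_max w (decpref w).+1 lt_d; rewrite ltnn => H; apply: notF; apply: H.
apply/(sorted_take_desc _ _ lt_d) => k.
rewrite ltnS leq_eqVlt => /orP[/eqP kd|]; last exact: dsc.
by rewrite -kd in nd.
Qed.

Lemma size_pop w : size (pop w) = size w.
Proof.
have [m] := ubnP (size w); elim: m w => // m IHm [|x w] lt_m //.
rewrite popE size_cat size_rev size_takel ?decpref_le //.
rewrite IHm; last first.
  by rewrite size_drop; have := decpref_gt0 x w; move: lt_m => /=; lia.
by rewrite size_drop subnKC ?decpref_le.
Qed.

(** This turns the recursion of [pop] into a reflection of positions: the first run is the block
    starting at 0, and the other blocks are those of the remaining suffix, shifted by
    [decpref w]. *)
Lemma nth_pop w i : i < size w ->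
  nth 0 (pop w) i = nth 0 w (block_rev (size w) (desc w) i).
Proof.
have [m] := ubnP (size w); elim: m w i => // m IHm w i lt_m lt_i.
have w_gt0 : 0 < size w by apply: leq_ltn_trans lt_i.
have d_gt0 : 0 < decpref w.
  by case: w w_gt0 {lt_m lt_i} => // x w _; apply: decpref_gt0.
have bd := decpref_block _ w_gt0.
have le_d := decpref_le w.
rewrite popE nth_cat size_rev size_takel //.
have [id|di] := ltnP i (decpref w).
  rewrite nth_rev size_takel // nth_take; last by lia.
  rewrite (block_revE _ _ (desc_lt w) _ _ _ bd); last by lia.
  by congr nth; lia.
rewrite IHm ?size_drop; [|by lia..].
rewrite nth_drop; congr nth; rewrite -size_drop.
set v := drop _ w.
have [a [b [[ab Jab nJa nJb] iab]]] := block_ex _ _ (desc_lt v) (i - decpref w).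
rewrite (block_revE _ _ (desc_lt v) a b) //.
rewrite (block_revE _ _ (desc_lt w) (decpref w + a) (decpref w + b)); [by lia| |by lia].
split=> [|k hk|_|]; rewrite ?leq_add2l // -?desc_drop //.
  rewrite -(subnKC (_ : decpref w <= k)) -?desc_drop; last by lia.
  by apply: Jab; lia.
(* When [a] is 0, the left boundary of the shifted block is the end of the first run. *)
have [a0|a_gt0] := posnP a; first by rewrite a0 addn0; case: bd.
rewrite (_ : (decpref w + a).-1 = decpref w + a.-1); last by lia.
by rewrite -desc_drop; apply: nJa.
Qed.

(** * Coding sortable permutations by words *)

(* In the words of type [seq (option bool)], [None] stands for the letter J,
   [Some false] for A and [Some true] for D. *)
Definition fall (t : seq (option bool)) (i : nat) : bool :=
  (i < size t) && (nth None t i == None).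

Definition inner_fall (t : seq (option bool)) (i : nat) : bool :=
  nth None t i == Some true.

(** The flag records whether the letter before the word is J, so that suffixes of a word can be
    counted by themselves. *)
Fixpoint admissible (prev_fall : bool) (t : seq (option bool)) : bool :=
  match t with
  | [::] => true
  | None :: t' => admissible true t'
  | Some d :: t' => (d ==> prev_fall || fall t' 0) && admissible false t'
  end.

Lemma admissibleP b t : admissible b t <->
  forall i, inner_fall t i ->
    fall t i.+1 || (if i is i'.+1 then fall t i' else b).
Proof.
elim: t b => [|[d|] t IHt] b /=; first by split=> // _ [|i].
  split=> [/andP[hd /IHt adm] [|i]|adm].
  - by rewrite /inner_fall /= => /eqP[d1]; move: hd; rewrite d1 orbC.
  - by move=> /adm; rewrite /fall /= ltnS; case: i => [|i] //=.
  apply/andP; split.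
    by apply/implyP => d1; have := adm 0; rewrite /inner_fall /= d1 orbC; apply.
  apply/IHt => i /(adm i.+1); rewrite /fall /= ltnS; case: i => [|i] //=.
split=> [/IHt adm [|i] //|adm].
  by move=> /adm; rewrite /fall /= ltnS; case: i => [|i]; rewrite ?orbT.
by apply/IHt => i /(adm i.+1); rewrite /fall /= ltnS; case: i.
Qed.

Definition encode (w : seq nat) : seq (option bool) :=
  mkseq (fun i => if desc w i then None else Some (desc (pop w) i)) (size w).-1.

(** Undoing two pops on the identity: the entry at [i] is the place to which the two successive
    reflections carry [i], plus 1 because values start at 1. *)
Definition decode (t : seq (option bool)) : seq nat :=
  mkseq (fun i => (block_rev (size t).+1 (inner_fall t)
                    (block_rev (size t).+1 (fall t) i)).+1) (size t).+1.

Lemma size_encode w : size (encode w) = (size w).-1.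
Proof. by rewrite size_mkseq. Qed.

Lemma size_decode t : size (decode t) = (size t).+1.
Proof. by rewrite size_mkseq. Qed.

Lemma nth_decode t i : i < (size t).+1 ->
  nth 0 (decode t) i = (block_rev (size t).+1 (inner_fall t)
                         (block_rev (size t).+1 (fall t) i)).+1.
Proof. exact: nth_mkseq. Qed.

Lemma fall_lt t i : fall t i -> i.+1 < (size t).+1.
Proof. by case/andP. Qed.

Lemma inner_fall_lt t i : inner_fall t i -> i.+1 < (size t).+1.
Proof.
rewrite /inner_fall ltnS ltnNge => h; apply/negP => le_t.
by rewrite nth_default in h.
Qed.

Lemma fall_inner t i : fall t i -> ~~ inner_fall t i.
Proof. by case/andP => _ /eqP; rewrite /inner_fall => ->. Qed.

(** * From sortable permutations to admissible words *)

Lemma mem_two_pop_sortable n w : w \in two_pop_sortable n =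
  perm_eq w (iota 1 n) && (pop (pop w) == iota 1 n).
Proof. by rewrite mem_filter mem_permutations andbC. Qed.

Lemma fall_encode w : fall (encode w) = desc w.
Proof.
apply/funext => i; rewrite /fall size_encode.
case: ltnP => [lt_i|le_i] /=; first by rewrite nth_mkseq //; case: (desc w i).
(* Past the end, the bound in [fall] keeps the default [None] from being read as a letter J. *)
by apply/esym/negP => /desc_lt; lia.
Qed.

(** Reversing a descending run turns its inner gaps into ascents. Hence the letter J in [encode]
    hides no descent of [pop w]. *)
Lemma pop_rise w i : desc w i -> ~~ desc (pop w) i.
Proof.
move=> di; have lt_i := desc_lt _ _ di.
have [k /andP[_ lt_k] [ri ri1]] := block_rev_gap _ _ (desc_lt w) _ di.
rewrite /desc size_pop lt_i /= !nth_pop ?(ltnW lt_i) // ri ri1.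
by rewrite -leqNgt ltnW.
Qed.

Lemma inner_fall_encode w : inner_fall (encode w) = desc (pop w).
Proof.
apply/funext => i; rewrite /inner_fall.
have [lt_i|le_i] := ltnP i (size w).-1.
  rewrite nth_mkseq //; case: ifP => [/pop_rise/negPf -> //|_].
  by case: (desc (pop w) i).
rewrite nth_default ?size_encode //.
by apply/esym/negP => /desc_lt; rewrite size_pop; lia.
Qed.

Lemma encodeK n w : w \in two_pop_sortable n.+1 -> decode (encode w) = w.
Proof.
rewrite mem_two_pop_sortable => /andP[/perm_size sz /eqP ppw].
rewrite size_iota in sz.
have sze : (size (encode w)).+1 = size w by rewrite size_encode sz.
apply: (@eq_from_nth _ 0) => [|i]; first by rewrite size_decode.
rewrite size_decode => lt_i; rewrite nth_mkseq //.
rewrite fall_encode inner_fall_encode sze; rewrite sze in lt_i.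
have lt_j := block_rev_lt _ _ (desc_lt w) _ lt_i.
set j := block_rev _ (desc w) i in lt_j *.
have dpw : forall k, desc (pop w) k -> k.+1 < size w.
  by move=> k /desc_lt; rewrite size_pop.
have lt_k := block_rev_lt _ _ dpw _ lt_j.
(* Follow the entry at [i]: one pop moves it to [j], the next to the reflection of [j], where the
   identity shows its value. *)
have := nth_pop (pop w) (block_rev (size w) (desc (pop w)) j).
rewrite size_pop => /(_ lt_k); rewrite block_revK // ppw.
rewrite nth_iota -?sz // nth_pop // /j block_revK //; exact: desc_lt.
Qed.

(** At a letter D, the ascent of [w] forces the reflected positions of [i] and [i.+1] into different
    layers. They can be that far apart only if a descending run of [w] of length at least 2 ends at
    [i] or starts at [i.+1]. *)
Lemma admissible_encode n w :
  w \in two_pop_sortable n.+1 -> admissible false (encode w).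
Proof.
move=> wP; have := encodeK _ _ wP; set t := encode w => dec_t.
apply/admissibleP => i Di.
have nJi : ~~ fall t i by apply/negP => /fall_inner; rewrite Di.
have lt_i := inner_fall_lt _ _ Di.
have uw : uniq w.
  move: wP; rewrite mem_two_pop_sortable => /andP[/perm_uniq -> _].
  exact: iota_uniq.
have : nth 0 w i < nth 0 w i.+1.
  have szw : size w = (size t).+1 by rewrite -dec_t size_decode.
  move: nJi; rewrite fall_encode /desc szw lt_i /= -leqNgt leq_eqVlt.
  case/orP => // /eqP/eqP; rewrite nth_uniq ?szw ?(ltnW lt_i) //.
  by move/eqP; lia.
rewrite -dec_t !nth_decode ?(ltnW lt_i) // ltnS.
have [] := block_rev_cut _ _ (fall_lt t) _ nJi.
set a := block_rev _ (fall t) i; set b := block_rev _ (fall t) i.+1.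
move=> [ai Jai _ _] [ib Jib _ _].
case/(block_rev_ltE _ _ (inner_fall_lt t)) => [|k hk nDk]; first by lia.
(* The separating gap [k] is not [i], which is a D; on either side it lies beyond a run that must
   contain the neighbouring J. *)
have [ik|ki|ki] := ltngtP i k.
- by rewrite Jib //; lia.
- have : fall t i.-1 by apply: Jai; lia.
  by case: (i) ki => // i' _ /= ->; rewrite orbT.
- by rewrite -ki Di in nDk.
Qed.

(** * From admissible words back to sortable permutations *)

Lemma perm_decode t : perm_eq (decode t) (iota 1 (size t).+1).
Proof.
have ud : uniq (decode t).
  rewrite map_inj_uniq ?iota_uniq // => i j [] /(can_inj (block_revK _ _ _)).
  move=> /(_ (inner_fall_lt t)) /(can_inj (block_revK _ _ _)); apply.
  exact: fall_lt.
have sub : {subset decode t <= iota 1 (size t).+1}.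
  move=> x /mapP[i]; rewrite !mem_iota /= add0n => lt_i ->.
  rewrite add1n !ltnS leq0n /=.
  apply: (block_rev_lt _ _ (inner_fall_lt t)).
  exact: (block_rev_lt _ _ (fall_lt t) _ lt_i).
have le_sz : size (iota 1 (size t).+1) <= size (decode t).
  by rewrite size_decode size_iota.
have [_ eq_mem] := uniq_min_size ud sub le_sz.
by apply: uniq_perm => //; apply: iota_uniq.
Qed.

Lemma desc_decode t : admissible false t -> desc (decode t) = fall t.
Proof.
move=> /admissibleP adm; apply/funext => i; rewrite /desc size_decode.
case: ltnP => [lt_i|le_i]; last by apply/esym/negP => /fall_lt; lia.
rewrite andTb !nth_decode ?(ltnW lt_i) // ltnS.
case Ji: (fall t i).
  have [k Jk [-> ->]] := block_rev_gap _ _ (fall_lt t) _ Ji.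
  apply/(block_rev_ltE _ _ (inner_fall_lt t)) => //.
  by exists k; rewrite ?fall_inner //; lia.
apply/negbTE; rewrite -leqNgt ltnW //.
have [] := block_rev_cut _ _ (fall_lt t) _ (negbT Ji).
set a := block_rev _ (fall t) i; set b := block_rev _ (fall t) i.+1.
move=> [ai _ nJa _] [ib _ _ nJb].
apply/(block_rev_ltE _ _ (inner_fall_lt t)); first by lia.
case Di: (inner_fall t i); last by exists i; rewrite ?Di //; lia.
(* The J next to a D is not itself a D, so it separates the layers of [a] and [b]. *)
have /orP[Ji1|Jpi] := adm _ Di.
  exists i.+1; last exact: fall_inner.
  suff: i.+1 != b by lia.
  by apply: contraNneq nJb => <-.
have i_gt0 : 0 < i by case: (i) Jpi.
have {}Jpi : fall t i.-1 by case: (i) Jpi.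
exists i.-1; last exact: fall_inner.
suff: a != i by lia.
by apply: contraTneq Jpi => ai'; rewrite -ai'; apply: nJa; rewrite ai'.
Qed.

Lemma nth_pop_decode t i : admissible false t -> i < (size t).+1 ->
  nth 0 (pop (decode t)) i = (block_rev (size t).+1 (inner_fall t) i).+1.
Proof.
move=> adm lt_i; rewrite nth_pop ?size_decode // desc_decode // nth_decode.
  by rewrite (block_revK _ _ (fall_lt t)).
exact: (block_rev_lt _ _ (fall_lt t) _ lt_i).
Qed.

Lemma desc_pop_decode t : admissible false t ->
  desc (pop (decode t)) = inner_fall t.
Proof.
move=> adm; apply/funext => i; rewrite /desc size_pop size_decode.
case: ltnP => [lt_i|le_i] /=; last by apply/esym/negP => /inner_fall_lt; lia.
rewrite !nth_pop_decode ?(ltnW lt_i) // ltnS.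
case Di: (inner_fall t i).
  have [k _ [-> ->]] := block_rev_gap _ _ (inner_fall_lt t) _ Di.
  exact: ltnSn.
apply/negbTE; rewrite -leqNgt ltnW //.
by apply/(block_rev_ltE _ _ (inner_fall_lt t)) => //; exists i; rewrite ?Di //; lia.
Qed.

(** Each pop cancels one of the two reflections in [decode]. *)
Lemma decode_sortable t : admissible false t ->
  decode t \in two_pop_sortable (size t).+1.
Proof.
move=> adm; rewrite mem_two_pop_sortable perm_decode andTb; apply/eqP.
apply: (@eq_from_nth _ 0) => [|i]; first by rewrite !size_pop size_decode size_iota.
rewrite !size_pop size_decode => lt_i.
rewrite nth_pop size_pop size_decode // desc_pop_decode //.
have lt_j := block_rev_lt _ _ (inner_fall_lt t) _ lt_i.
rewrite nth_pop_decode // block_revK ?nth_iota //; exact: inner_fall_lt.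
Qed.

Lemma decodeK t : admissible false t -> encode (decode t) = t.
Proof.
move=> adm; apply: (@eq_from_nth _ None) => [|i]; rewrite size_encode size_decode //.
move=> lt_i; rewrite nth_mkseq ?size_decode // desc_decode // desc_pop_decode //.
by rewrite /fall /inner_fall lt_i; case: nth => [[]|].
Qed.

Lemma asc_encode n w : w \in two_pop_sortable n.+1 ->
  asc w = count isSome (encode w).
Proof.
rewrite mem_two_pop_sortable => /andP[/perm_uniq uw _].
rewrite iota_uniq in uw.
rewrite /asc count_map; apply: eq_in_count => i; rewrite mem_iota add0n ltn_predRL.
move=> /= lt_i1.
rewrite /desc lt_i1 /=; case: ltngtP => // /eqP.
by rewrite nth_uniq ?(ltnW lt_i1) // => /eqP; lia.
Qed.

(** * Counting admissible words *)

Fixpoint words (n : nat) : seq (seq (option bool)) :=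
  if n is n'.+1 then
    map (cons None) (words n') ++
    map (cons (Some false)) (words n') ++ map (cons (Some true)) (words n')
  else [:: [::]].

Lemma mem_map_cons (T : eqType) (a b : T) (s : seq T) (r : seq (seq T)) :
  (a :: s \in map (cons b) r) = (a == b) && (s \in r).
Proof.
apply/mapP/andP => [[u ur [-> ->]]|[/eqP -> sr]]; first by rewrite eqxx.
by exists s.
Qed.

Lemma mem_words n t : (t \in words n) = (size t == n).
Proof.
elim: n t => [|n IHn] [|a t] //=.
  by rewrite !mem_cat; apply/negbTE; rewrite !negb_or; apply/and3P; split;
    apply/mapP => -[].
by rewrite !mem_cat !mem_map_cons IHn eqSS; case: a => [[]|] /=; rewrite ?orbF.
Qed.

Lemma words_uniq n : uniq (words n).
Proof.
elim: n => //= n IHn.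
have inj a : injective (cons a : seq (option bool) -> _) by move=> s t [].
rewrite !cat_uniq !(map_inj_uniq (inj _)) IHn /= andbT; apply/andP; split.
  apply/hasPn => t; rewrite mem_cat => /orP[] /mapP[u _ ->];
  by rewrite mem_map_cons.
by apply/hasPn => t /mapP[u _ ->]; rewrite mem_map_cons.
Qed.

Lemma perm_encode n :
  perm_eq (map encode (two_pop_sortable n.+1))
          [seq t <- words n | admissible false t].
Proof.
have szw w : w \in two_pop_sortable n.+1 -> size w = n.+1.
  by rewrite mem_two_pop_sortable => /andP[/perm_size ->]; rewrite size_iota.
apply: uniq_perm.
- rewrite map_inj_in_uniq; first exact/filter_uniq/permutations_uniq.
  exact: can_in_inj (encodeK n).
- exact/filter_uniq/words_uniq.
move=> t; rewrite mem_filter mem_words.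
apply/mapP/andP => [[w wP ->]|[adm /eqP szt]].
  by rewrite size_encode szw //; split=> //; apply: admissible_encode wP.
exists (decode t); last by rewrite decodeK.
by rewrite -szt; apply: decode_sortable.
Qed.

(** These are the coefficients of G for [true] and of H for [false]. *)
Definition admissible_count (b : bool) (n k : nat) : nat :=
  count (fun t => admissible b t && (count isSome t == k)) (words n).

Lemma asc_countS n k : asc_count n.+1 k = admissible_count false n k.
Proof.
rewrite /asc_count /admissible_count.
transitivity (count (fun t => count isSome t == k)
                (map encode (two_pop_sortable n.+1))).
  rewrite count_map; apply: eq_in_count => w wP /=.
  by rewrite (asc_encode n).
rewrite (permP (perm_encode n)) count_filter.
by apply: eq_count => t /=; rewrite andbC.
Qed.

Lemma asc_count0 k : asc_count 0 k = (k == 0).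
Proof. by rewrite /asc_count /two_pop_sortable /= eq_sym addn0. Qed.

Lemma admissible_count0 b k : admissible_count b 0 k = (k == 0).
Proof. by rewrite /admissible_count /= eq_sym addn0. Qed.

(** The effect on coefficients of multiplication by y. *)
Definition pred_count (f : nat -> nat) (k : nat) : nat :=
  if k is k'.+1 then f k' else 0.

Lemma count_cons_some (P : pred (seq (option bool))) r k :
  count (fun t => P t && (1 + count isSome t == k)) r =
  pred_count (fun k' => count (fun t => P t && (count isSome t == k')) r) k.
Proof.
case: k => [|k] //=.
by rewrite (eq_count (a2 := pred0)) ?count_pred0 // => t; rewrite /= andbF.
Qed.

(** After a J both A and D are free, hence the factor 2. *)
Lemma admissible_count_true n k : admissible_count true n.+1 k =
  admissible_count true n k + 2 * pred_count (admissible_count false n) k.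
Proof.
rewrite {1}/admissible_count /= !count_cat !count_map /=.
by rewrite !count_cons_some mul2n -addnn.
Qed.

Lemma count_fall_words (P : pred (seq (option bool))) n :
  count (fun t => fall t 0 && P t) (words n) =
  if n is n'.+1 then count (fun t => P (None :: t)) (words n') else 0.
Proof.
case: n => //= n; rewrite !count_cat !count_map.
rewrite [X in _ + (X + _)](eq_count (a2 := pred0)) //.
rewrite [X in _ + (_ + X)](eq_count (a2 := pred0)) //.
by rewrite !count_pred0 !addn0.
Qed.

(** A D not preceded by J must be followed by J; the last term counts the words starting with these
    two letters. *)
Lemma admissible_count_false n k : admissible_count false n.+1 k =
  admissible_count true n k + pred_count (admissible_count false n) k +
  pred_count (fun k' => if n is n'.+1 then admissible_count true n' k' else 0) k.
Proof.
rewrite {1}/admissible_count /= !count_cat !count_map /= !count_cons_some addnA.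
congr (_ + _ + _); case: k => //= k.
under eq_count => t do rewrite -andbA.
by rewrite (count_fall_words (fun t => admissible false t && (count isSome t == k))).
Qed.

Local Open Scope ring_scope.

(** * Generating functions *)

Section Monomials.
Variable R : comNzRingType.
Let x : fps2 R := fps2_x R.
Let y : fps2 R := fps2_y R.

Lemma coef2xM0 (f : fps2 R) j : (x * f) 0%N j = 0.
Proof.
by rewrite coef2M big1 // => a _; rewrite big1 // => b _; rewrite ord1 mul0r.
Qed.

Lemma coef2xMS (f : fps2 R) i j : (x * f) i.+1 j = f i j.
Proof.
rewrite coef2M big_ord_recl big1 ?add0r => [|b _]; last by rewrite mul0r.
rewrite big_ord_recl [X in _ + X]big1 ?addr0 => [|a _]; last first.
  by rewrite big1 // => b _; rewrite mul0r.
rewrite big_ord_recl [X in _ + X]big1 ?addr0 => [|b _]; last by rewrite mul0r.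
by rewrite mul1r subn0 subn1.
Qed.

Lemma coef2yM0 (f : fps2 R) i : (y * f) i 0%N = 0.
Proof.
by rewrite coef2M big1 // => a _; rewrite big_ord1 /= andbF mul0r.
Qed.

Lemma coef2yMS (f : fps2 R) i j : (y * f) i j.+1 = f i j.
Proof.
rewrite coef2M big_ord_recl [X in _ + X]big1 ?addr0 => [|a _]; last first.
  by rewrite big1 // => b _; rewrite mul0r.
rewrite big_ord_recl mul0r add0r.
rewrite big_ord_recl [X in _ + X]big1 ?addr0 => [|b _]; last by rewrite mul0r.
by rewrite mul1r subn0 subn1.
Qed.

Lemma coef2_monomial n k i j :
  (x ^+ n * y ^+ k) i j = ((i == n) && (j == k))%:R.
Proof.
elim: n i j => [|n IHn] i j; last first.
  rewrite exprS -mulrA; case: i => [|i]; first by rewrite coef2xM0.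
  by rewrite coef2xMS IHn eqSS.
rewrite expr0 mul1r; elim: k j => [|k IHk] j; first by rewrite expr0 coef21.
rewrite exprS; case: j => [|j]; first by rewrite coef2yM0 andbF.
by rewrite coef2yMS IHk eqSS.
Qed.

Lemma coef2Mn (f : fps2 R) n i j : (f *+ n) i j = f i j *+ n.
Proof. by elim: n => // n IHn; rewrite !mulrS coef2D IHn. Qed.

(** A finite list holding every index that contributes to a coefficient gives both finiteness and
    the value of the sum. *)
Lemma fps2_has_sum_seq (I : choiceType) (A : set I) (F : I -> fps2 R)
    (S : fps2 R) (r : nat -> nat -> seq I) :
  (forall i j, uniq (r i j)) ->
  (forall i j t, t \in r i j -> A t) ->
  (forall i j t, A t -> F t i j != 0 -> t \in r i j) ->
  (forall i j, S i j = \sum_(t <- r i j) F t i j) ->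
  fps2_has_sum A F S.
Proof.
move=> r_uniq rA Fr SE i j; split.
  apply: (@sub_finite_set _ _ [set` r i j]%classic); last exact: finite_seq.
  by move=> t [At Ft] /=; apply: Fr.
rewrite SE (fsbig_seq _ _ (r_uniq i j)); apply: fsbig_widen => [t /=|t [At /= nr]].
  exact: rA.
by apply/eqP; apply: contraT => /(Fr _ _ _ At).
Qed.

End Monomials.

(** * The transfer equations and their solution *)

Section GeneratingFunction.
Let x : fps2 int := fps2_x int.
Let y : fps2 int := fps2_y int.

Definition asc_series : fps2 int := Fps2 (fun n k => (asc_count n k)%:R).

Definition admissible_series (b : bool) : fps2 int :=
  Fps2 (fun n k => (admissible_count b n k)%:R).

Lemma coef_asc_series n k : asc_series n k = (asc_count n k)%:R.
Proof. by []. Qed.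

Lemma coef_admissible_series b n k :
  admissible_series b n k = (admissible_count b n k)%:R.
Proof. by []. Qed.

(** The 1 is the empty permutation; the factor [x] makes up for a word being one shorter than its
    permutation. *)
Lemma asc_seriesE : asc_series = 1 + x * admissible_series false.
Proof.
apply: fps2P => i j; rewrite coef2D coef21 coef_asc_series.
case: i => [|i]; first by rewrite coef2xM0 asc_count0 addr0.
by rewrite coef2xMS asc_countS add0r.
Qed.

Lemma admissible_series_true : admissible_series true =
  1 + x * admissible_series true + 2 * (x * (y * admissible_series false)).
Proof.
apply: fps2P => i j.
rewrite mulr_natl mulr2n !coef2D coef21 coef_admissible_series.
case: i => [|i]; first by rewrite !coef2xM0 admissible_count0 !addr0.
rewrite !coef2xMS admissible_count_true add0r natrD natrM mulr_natl mulr2n.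
by case: j => [|j]; rewrite ?coef2yM0 ?coef2yMS.
Qed.

Lemma admissible_series_false : admissible_series false =
  1 + x * admissible_series true + x * (y * admissible_series false)
  + x * (y * (x * admissible_series true)).
Proof.
apply: fps2P => i j; rewrite !coef2D coef21 coef_admissible_series.
case: i => [|i]; first by rewrite !coef2xM0 admissible_count0 !addr0.
rewrite !coef2xMS admissible_count_false add0r !natrD.
case: j => [|j]; first by rewrite !coef2yM0.
by rewrite !coef2yMS; case: i => [|i]; rewrite ?coef2xM0 ?coef2xMS.
Qed.

Lemma asc_series_mul :
  asc_series * (1 - x - x * y - x ^+ 2 * y - 2 * x ^+ 3 * y ^+ 2) =
  1 - x * y - x ^+ 2 * y + x ^+ 3 * y - 2 * x ^+ 3 * y ^+ 2.
Proof.
have Ht := admissible_series_true; have Hf := admissible_series_false.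
rewrite asc_seriesE.
move: (admissible_series true) (admissible_series false) Ht Hf => T F Ht Hf.
(* eliminate [T] from the transfer equations by Cramer's rule *)
have H : F * (1 - x - x * y - x ^+ 2 * y - 2 * x ^+ 3 * y ^+ 2) = 1 + x ^+ 2 * y.
  have Ht' : T - (1 + x * T + 2 * (x * (y * F))) = 0 by rewrite -Ht subrr.
  have Hf' : F - (1 + x * T + x * (y * F) + x * (y * (x * T))) = 0.
    by rewrite -Hf subrr.
  apply/eqP; rewrite -subr_eq0; apply/eqP.
  transitivity ((1 - x) * (F - (1 + x * T + x * (y * F) + x * (y * (x * T))))
     + (x + x ^+ 2 * y) * (T - (1 + x * T + 2 * (x * (y * F))))); first by ring.
  by rewrite Ht' Hf' !mulr0 addr0.
(* The numerator is the denominator plus [x * (1 + x ^+ 2 * y)]. *)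
by rewrite mulrDl mul1r -(mulrA x F) H; ring.
Qed.

End GeneratingFunction.

Theorem theorem2 :
  let x : fps2 int := fps2_x int in
  let y : fps2 int := fps2_y int in
  let Q : fps2 int :=
    (1 - x * y - x ^+ 2 * y + x ^+ 3 * y - 2 * x ^+ 3 * y ^+ 2)
    / (1 - x - x * y - x ^+ 2 * y - 2 * x ^+ 3 * y ^+ 2) in
  fps2_has_sum two_pop_sortable_all (fun w => x ^+ size w * y ^+ asc w) Q
  /\ fps2_has_sum [set: nat * nat]%classic
       (fun nk => (asc_count nk.1 nk.2)%:R * x ^+ nk.1 * y ^+ nk.2) Q.
Proof.
move=> x y Q.
have QE : Q = asc_series.
  (* The denominator has constant coefficient 1, so the division is genuine. *)
  rewrite /Q -asc_series_mul mulrK //; apply: fps2_unit_coef1.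
  rewrite -!mulrA mulr_natl !coef2D !coef2N coef2Mn coef21.
  by rewrite !coef2xM0 mul0rn !subr0.
have szP n w : w \in two_pop_sortable n -> size w = n.
  by rewrite mem_two_pop_sortable => /andP[/perm_size ->]; rewrite size_iota.
rewrite QE; split.
  (* Only permutations of length [n] contribute to the coefficients of x^n, whatever the power of
     y. *)
  apply: (@fps2_has_sum_seq _ _ _ _ _ (fun n _ => two_pop_sortable n)).
  - by move=> i _; apply/filter_uniq/permutations_uniq.
  - by move=> i _ w wP; exists i.
  - move=> i j w [n wP]; rewrite coef2_monomial (szP _ _ wP).
    by case: (i =P n) => [->|].
  move=> i j; rewrite coef_asc_series /asc_count -sum1_count natr_sum big_mkcond.
  apply: eq_big_seq => w wP; rewrite coef2_monomial (szP _ _ wP) eqxx eq_sym.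
  by case: eqP.
have coefE n k i j : ((asc_count n k)%:R * x ^+ n * y ^+ k) i j
    = (if (i, j) == (n, k) then (asc_count n k)%:R else 0).
  rewrite -mulrA mulr_natl coef2Mn coef2_monomial -xpair_eqE.
  by case: eqP; rewrite ?mul0rn.
apply: (@fps2_has_sum_seq _ _ _ _ _ (fun i j => [:: (i, j)])) => //.
  by move=> i j [n k] _; rewrite coefE inE (eq_sym (n, k)); case: ifP.
by move=> i j; rewrite big_seq1 coefE eqxx.
Qed.
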